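(* Let $G$ be a directed graph with generic non-negative dart weights, cellularly embedded on an orientable surface of genus $g\ge 1$, and let $f$ be a face of $G$. As the source point $s$ moves once around the boundary of $f$, each dart of $G$ pivots into (or out of) the shortest-path tree rooted at $s$ at most $O(g)$ times.
   Context: Surfaces are compact connected 2-manifolds. The directed edges of $G$ are called darts; $u\to v$ is a dart with tail $u$ and head $v$. Whenever $G$ contains a dart it also contains its reversal; the edge $uv$ is the pair $\{u\to v,v\to u\}$, and the two darts may have different finite non-negative weights $w$. An embedding of $G$ is an embedding of its underlying undirected graph; it is cellular if every face is an open disk. Moving the source. The source point $s$ moves continuously along the facial walk bounding $f$, edge by edge (an edge occurring twice in the facial walk is traversed twice). While $s$ moves from $u$ to $v$ along an edge $uv$, its position is given by $\lambda\in[0,1]$ increasing from $0$ to $1$: the edge $uv$ is subdivided by $s$ with weights $w_\lambda(u\to s)=\lambda w(u\to v)$, $w_\lambda(s\to v)=(1-\lambda)w(u\to v)$, $w_\lambda(s\to u)=\lambda w(v\to u)$, $w_\lambda(v\to s)=(1-\lambda)w(v\to u)$, and all other weights are unchanged. Let $T_\lambda$ be the shortest-path tree rooted at $s$, $\mathrm{dist}_\lambda$ the distance from $s$, and $\mathrm{slack}_\lambda(x\to y)=\mathrm{dist}_\lambda(x)+w_\lambda(x\to y)-\mathrm{dist}_\lambda(y)$. At a critical value of $\lambda$ the slack of some dart $y\to z$ not in $T_\lambda$ (with $z\neq s$) decreases to zero, so that it is just about to become tense (have negative slack); then $y\to z$ pivots into the tree, replacing the tree dart $x\to z$ currently entering $z$,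 which pivots out. The weights are generic if all vertex-to-vertex shortest paths in $G$ are unique and exactly one dart becomes tense at each critical value. *)

(* Defs.v *)
From HB Require Import structures.
From mathcomp Require Import all_boot all_order all_algebra all_fingroup.
From mathcomp Require Import boolp classical_sets cardinality reals.

Set Implicit Arguments.
Unset Strict Implicit.
Unset Printing Implicit Defensive.

Import Order.TTheory GRing.Theory Num.Theory.

Local Open Scope ring_scope.

(* Loops and parallel darts are allowed. *)
Record digraph := Digraph {
  vert : finType;
  dart : finType;
  dtail : dart -> vert;
  dhead : dart -> vert
}.

Section ShortestPaths.
Variables (R : realType) (G : digraph).
Implicit Types (w : dart G -> R) (A T : {set dart G}) (x y r : vert G)
  (d : dart G) (p : seq (dart G)).

Fixpoint is_walk x p y : bool :=
  if p is d :: q then (dtail d == x) && is_walk (dhead d) q y else x == y.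

Definition walk_in A x p y : bool := is_walk x p y && all (mem A) p.

Definition is_path x p y : bool := is_walk x p y && uniq (x :: map (@dhead G) p).

Definition weight w p : R := \sum_(d <- p) w d.

(* Distance from x to y using only the darts of A. *)
Definition dist_in w A x y : R :=
  inf [set weight w p | p in [set p | walk_in A x p y]]%classic.

Definition dist w x y : R := dist_in w [set: dart G] x y.

Definition is_shortest_path w x p y : Prop :=
  is_path x p y /\ weight w p = dist w x y.

(* T is a spanning tree directed away from r, all of whose paths from r are
   shortest; being such a tree is expressed by the existence and uniqueness of
   a walk from r to each vertex inside T. *)
Definition is_spt w r T : Prop :=
  forall y, exists2 p, walk_in T r p y /\ weight w p = dist w r y &
                       forall q, walk_in T r q y -> q = p.

(* Slack of d when the distances from r are measured along the darts of A. *)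
Definition slack_in w A r d : R :=
  dist_in w A r (dtail d) + w d - dist_in w A r (dhead d).

Definition slack w r d : R := slack_in w [set: dart G] r d.

End ShortestPaths.

(* A cellular embedding on an orientable surface, given by its rotation
   system: rot cyclically permutes the darts leaving each vertex. *)
Record embedded_graph := EmbeddedGraph {
  graph_of :> digraph;
  drev : {perm dart graph_of};
  rot : {perm dart graph_of};
  drevK : involutive drev;
  drev_neq : forall d, drev d != d;
  dtail_rev : forall d, dtail (drev d) = dhead d;
  porbit_rotE : forall d d', (d' \in porbit rot d) = (dtail d' == dtail d);
  graph_connected : forall x y : vert graph_of, exists p, is_walk x p y
}.

(* The facial walk arriving at v along d leaves v along the dart that follows
   drev d in the rotation at v. *)
Definition face_next (G : embedded_graph) : {perm dart G} :=
  (drev G * rot G)%g.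

(* A face is the set of darts of its facial walk, oriented as they are
   traversed; an edge traversed twice contributes both of its darts. *)
Definition faces (G : embedded_graph) : {set {set dart G}} :=
  porbits (face_next G).

Definition euler_char (G : embedded_graph) : int :=
  #|vert G|%:Z - #|porbits (drev G)|%:Z + #|faces G|%:Z.

Definition has_genus (G : embedded_graph) (g : nat) : Prop :=
  euler_char G = 2 - 2 * g%:Z.

Section MovingSource.
Variables (R : realType) (G : embedded_graph) (w : dart G -> R).
Implicit Types (e d : dart G) (l : R).

(* G with the edge of e = u -> v subdivided by the source s = None.
   For d not in {e, drev e}, inl d is d itself; inl e is s -> v and
   inl (drev e) is s -> u, so that inl d is always the part of d that enters
   dhead d; inr true is u -> s and inr false is v -> s.  The darts whose head
   is not s are thus exactly the inl d. *)
Definition sub_graph e : digraph := @Digraph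
  (option (vert G)) (dart G + bool)%type
  (fun a => match a with
            | inl d => if d \in [set e; drev G e] then None else Some (dtail d)
            | inr b => Some (if b then dtail e else dhead e)
            end)
  (fun a => match a with
            | inl d => Some (dhead d)
            | inr _ => None
            end).

Definition sub_weight e l (a : dart (sub_graph e)) : R :=
  match a with
  | inl d => if d == e then (1 - l) * w e
             else if d == drev G e then l * w (drev G e)
             else w d
  | inr b => if b then l * w e else (1 - l) * w (drev G e)
  end.

Definition source e : vert (sub_graph e) := None.

(* With s at parameter l on e and T the current shortest-path tree, d is not in
   T, its slack is zero, and it is about to become tense.  The slack after l
   is measured along the tree T: it is this slack that turns negative if T is
   not updated.  It is affine in l, so that it also decreases to zero. *)
Definition becomes_tense e l (T : {set dart (sub_graph e)}) d : Prop :=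
  [/\ is_spt (sub_weight l) (source e) T,
      (inl d : dart (sub_graph e)) \notin T,
      slack (sub_weight l) (source e) (inl d) = 0 &
      exists2 eps : R, 0 < eps & forall l', l < l' < l + eps ->
        slack_in (sub_weight l') T (source e) (inl d) < 0].

(* The positions of s during one turn around f, each one occurring once: the
   end of an edge is the beginning (l = 0) of the next one. *)
Definition position (f : {set dart G}) (q : dart G * R) : Prop :=
  q.1 \in f /\ 0 <= q.2 < 1.

Definition pivots_in d (q : dart G * R) : Prop :=
  exists T, @becomes_tense q.1 q.2 T d.

Definition pivots_out d (q : dart G * R) : Prop :=
  exists T d', [/\ @becomes_tense q.1 q.2 T d',
    (inl d : dart (sub_graph q.1)) \in T & dhead d = dhead d'].

Definition generic (f : {set dart G}) : Prop :=
  (forall x y p p', is_shortest_path w x p y -> is_shortest_path w x p' y ->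
     p = p') /\
  (forall q, position f q -> forall T d d',
     @becomes_tense q.1 q.2 T d -> @becomes_tense q.1 q.2 T d' -> d = d').

End MovingSource.

(* Main.v *)
(* Fix a dart d with head y.  The shortest paths in G from all vertices to y form
   an in-tree; let A be the set of vertices whose path uses d.  While s moves
   along an edge u -> v, the distance to y is the minimum of a nondecreasing
   function of lambda (paths through u) and a nonincreasing one (paths through
   v), so the tree dart entering y changes at most once, from the last dart of
   the path of u to that of v.  Hence d pivots only on its own edge or on an
   edge of the facial walk of f that crosses between A and its complement.

   Let e_1, ..., e_k be the darts of f that leave A (or its complement), and
   remove d from the in-tree, leaving a forest that does not cross A.  Take a
   potential on the faces over F_2 that vanishes on f and agrees across every
   edge other than the e_i and the forest edges.  Walk around the part of the
   forest lying in A, starting at e_i: the potential is constant until the walk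
   arrives, from f, at some e_j, so the potential also agrees across e_i.  Its
   boundary is therefore a cycle supported on a forest, hence zero, and the
   potential is constant.  Counting potentials gives
   F - 1 <= E - (V - 2) - k, that is, k <= 2g + 1. *)
Require Import Defs.
From HB Require Import structures.
From mathcomp Require Import all_boot all_order all_algebra all_fingroup.
From mathcomp Require Import zify ring lra.
From mathcomp Require Import boolp classical_sets cardinality reals.

Set Implicit Arguments.
Unset Strict Implicit.
Unset Printing Implicit Defensive.

Import Order.TTheory GRing.Theory Num.Theory.

Local Open Scope card_scope.
Local Open Scope ring_scope.

Lemma off_support (T : finType) (Z : zmodType) (h : T -> Z) (D : {set T}) t :
  0.-support h \subset D -> t \notin D -> h t = 0.
Proof.
move=> /fintype.subsetP hD tD; apply/eqP; apply: contraNT tD => ht.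
exact: hD.
Qed.

(** * Boundary darts leaving a vertex set that a forest with roots [x] and [y] does not cross *)

Section Cut.
Variables (G : embedded_graph) (x y : vert G) (par : vert G -> dart G)
  (depth : vert G -> nat) (S : {set vert G}) (f : {set dart G}).

Let F := [set v : vert G | (v != x) && (v != y)].

Hypothesis tail_par : forall v, v \in F -> dtail (par v) = v.
Hypothesis depth_par : forall v, v \in F -> (depth (dhead (par v)) < depth v)%N.
Hypothesis par_cut : forall v, v \in F -> (v \in S) = (dhead (par v) \in S).
Hypothesis face_f : f \in faces G.

Let exits := [set a in f | (dtail a \in S) && (dhead a \notin S)].

Let forest := [set a | [exists v in F, (a == par v) || (a == drev G (par v))]].

Lemma forest_par v : v \in F -> par v \in forest.
Proof.
by move=> Fv; rewrite inE; apply/exists_inP; exists v; rewrite ?eqxx.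
Qed.

Lemma forest_rev a : (drev G a \in forest) = (a \in forest).
Proof.
have half b : b \in forest -> drev G b \in forest.
  rewrite !inE => /exists_inP[v Fv /orP[] /eqP->];
    apply/exists_inP; exists v => //.
    by rewrite eqxx orbT.
  by rewrite drevK eqxx.
by apply/idP/idP => /half //; rewrite drevK.
Qed.

Lemma dhead_rev a : dhead (drev G a) = dtail a.
Proof. by rewrite -dtail_rev drevK. Qed.

Lemma dtail_rot a : dtail (Defs.rot G a) = dtail a.
Proof. by apply/eqP; rewrite -porbit_rotE -[Defs.rot G]expg1 mem_porbit. Qed.

Lemma forest_cut a : a \in forest -> (dtail a \in S) = (dhead a \in S).
Proof.
rewrite inE => /exists_inP[v Fv /orP[] /eqP->].
  by rewrite tail_par // par_cut.
by rewrite dtail_rev dhead_rev tail_par // -par_cut.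
Qed.

Lemma exits_forest a : a \in exits -> a \notin forest.
Proof.
rewrite inE => /and3P[_ aS aNS]; apply/negP => /forest_cut.
by rewrite aS (negPf aNS).
Qed.

(** * Face potentials, read on darts, that agree across all edges except forest edges and exits *)

Section Potential.
Variables (Z : zmodType) (U : dart G -> Z) (z : Z).
Hypothesis U_next : forall a, U (face_next G a) = U a.
Hypothesis U_f : forall a, a \in f -> U a = z.
Hypothesis U_rev : forall a, a \notin forest -> a \notin exits ->
  drev G a \notin exits -> U (drev G a) = U a.

(* Walks around a tree of the forest, crossing the other edges it meets. *)
Let contour a := Defs.rot G (if a \in forest then drev G a else a).

Let U_rot a : U (Defs.rot G a) = U (drev G a).
Proof. by rewrite -(U_next (drev G a)) permM drevK. Qed.

Let contour_inj : injective contour.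
Proof.
move=> a b /perm_inj; case: ifP => Ha; case: ifP => Hb //.
- exact: perm_inj.
- by move=> E; rewrite -E forest_rev Ha in Hb.
- by move=> E; rewrite E forest_rev Hb in Ha.
Qed.

Let contour_S a : (dtail (contour a) \in S) = (dtail a \in S).
Proof.
by rewrite dtail_rot; case: ifP => // /forest_cut; rewrite dtail_rev.
Qed.

Let U_contour a : dtail a \in S -> a \notin exits -> U (contour a) = U a.
Proof.
move=> aS aN; rewrite U_rot; case: ifPn => [_|aT]; first by rewrite drevK.
by apply: U_rev => //; rewrite !inE dhead_rev aS !andbF.
Qed.

(** Up to the first exit that the contour meets, [U] does not change along it; that exit lies on
    [f], where [U] is [z]. *)
Let U_contour_exit n a : dtail a \in S -> iter n.+1 contour a \in exits ->
  U (contour a) = z.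
Proof.
elim: n a => [|n IH] a aS Ha.
  by apply: U_f; move: Ha; rewrite inE => /andP[].
have bS : dtail (contour a) \in S by rewrite contour_S.
have [|aN] := boolP (contour a \in exits).
  by rewrite inE => /andP[/U_f].
by rewrite -(U_contour bS aN); apply: IH => //; rewrite -iterSr.
Qed.

(** [contour] is injective, so its orbit through an exit closes up and reaches an exit again. Hence
    [U] is [z] just after [a], which is the value on the other side of [a]. *)
Lemma U_exit a : a \in exits -> U (drev G a) = U a.
Proof.
move=> aE; have := aE; rewrite inE => /and3P[af aS _].
rewrite (U_f af) -(@U_contour_exit (fingraph.order contour a).-1 a aS);
  last first.
  by rewrite prednK ?fingraph.order_gt0 // fingraph.iter_order.
by rewrite U_rot (negPf (exits_forest aE)).
Qed.

Lemma U_nonforest a : a \notin forest -> U (drev G a) = U a.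
Proof.
move=> aF; have [/U_exit //|aE] := boolP (a \in exits).
have [/U_exit|] := boolP (drev G a \in exits); first by rewrite drevK.
exact: U_rev.
Qed.

(** Reindexing by the rotation at [v] turns the sum of [U a] into that of [U (drev a)]. *)
Let circulation v : \sum_(a | dtail a == v) (U a - U (drev G a)) = 0.
Proof.
rewrite sumrB; apply/eqP; rewrite subr_eq0; apply/eqP.
rewrite (reindex_inj (@perm_inj _ (Defs.rot G))) /=.
by apply: eq_big => a; rewrite ?dtail_rot // U_rot.
Qed.

(** Induction from the deepest vertices towards the roots. A forest dart leaving [v] other than
    [par v] reverses the parent dart of a deeper vertex, so [par v] is the only term of the
    circulation at [v] left to vanish. *)
Let U_par v : v \in F -> U (drev G (par v)) = U (par v).
Proof.
have [n] := ubnP (\max_u depth u - depth v); elim: n v => // n IH v.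
rewrite ltnS => le_n Fv; apply/eqP; rewrite eq_sym -subr_eq0; apply/eqP.
rewrite -[RHS](circulation v) (bigD1 (par v)) /= ?tail_par // big1 ?addr0 //.
move=> a /andP[/eqP av a_par]; apply/eqP; rewrite subr_eq0 eq_sym; apply/eqP.
have [|/U_nonforest //] := boolP (a \in forest).
rewrite inE => /exists_inP[u Fu /orP[] /eqP Ea].
  by move: av a_par; rewrite Ea tail_par // => ->; rewrite eqxx.
rewrite Ea drevK; apply/esym/IH => //.
have := depth_par Fu; have := leq_bigmax u (F := depth).
by rewrite -dtail_rev -Ea av; lia.
Qed.

(** [U] now agrees across every edge, hence around every vertex, and connectivity carries the value
    to a dart of [f]. *)
Lemma U_const a : U a = z.
Proof.
have revE b : U (drev G b) = U b.
  have [|/U_nonforest //] := boolP (b \in forest).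
  rewrite inE => /exists_inP[u Fu /orP[] /eqP->]; first exact: U_par.
  by rewrite drevK U_par.
have tailE b c : dtail b = dtail c -> U b = U c.
  move/eqP; rewrite -porbit_rotE porbit_sym => /porbitP[n ->].
  elim: n => [|n IH]; first by rewrite expg0 perm1.
  by rewrite expgSr permM U_rot revE.
have walkE p b v : is_walk (dtail b) p v -> forall c, dtail c = v -> U b = U c.
  elim: p b => [|d p IH] b /=.
    by move=> /eqP Ev c Ec; apply: tailE; rewrite Ev.
  case/andP=> /eqP db pv c cv; rewrite -(tailE _ _ db) -revE.
  by apply: IH cv; rewrite dtail_rev.
case/imsetP: face_f => b _ fE.
have [p Hp] := graph_connected (dtail a) (dtail b).
by rewrite (walkE _ _ _ Hp b) // U_f // fE porbit_id.
Qed.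

End Potential.

(** * Counting edges and potentials *)

Local Open Scope nat_scope.

Lemma porbit_drev a : porbit (drev G) a = [set a; drev G a].
Proof.
apply/setP=> b; rewrite !inE; apply/porbitP/orP.
  case=> n ->; rewrite -[n]odd_double_half expgD permM.
  have -> : ((drev G ^+ n./2.*2)%g =1 id).
    move=> c; rewrite -mul2n expgM.
    elim: n./2 => [|m IH]; first by rewrite perm1.
    by rewrite expgSr permM IH expgS expg1 permM drevK.
  by case: odd; rewrite ?expg1 ?expg0 ?perm1 eqxx; auto.
case=> /eqP->; first by exists 0; rewrite expg0 perm1.
by exists 1; rewrite expg1.
Qed.

(** No two darts among the exits and the parent darts are reversals of each other: two exits would
    have incompatible ends, the forest is closed under reversal and contains no exit, and two parent
    darts would make [depth] decrease both ways. *)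
Lemma card_free_edges :
  #|exits| + #|F| <= #|porbits (drev G) :&:
                       [set porbit (drev G) a | a in exits :|: forest]|.
Proof.
pose X := [set par v | v in F].
have cX : #|X| = #|F|.
  by apply: card_in_imset => u v Fu Fv E; rewrite -(tail_par Fu) E tail_par.
have dis : #|exits :&: X| = 0.
  apply: eq_card0 => a; apply/negP => /setIP[/exits_forest aN /imsetP[v Fv Ea]].
  by rewrite Ea forest_par in aN.
rewrite -cX -cardsUI dis addn0.
rewrite -(@card_in_imset _ _ (porbit (drev G)) (exits :|: X)).
  apply/subset_leq_card/fintype.subsetP => E /imsetP[a aX ->].
  apply/setIP; split; apply: imset_f => //.
  case/finset.setUP: aX; rewrite finset.in_setU; first by move->.
  by case/imsetP=> v Fv ->; rewrite forest_par // orbT.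
move=> a b aX bX /eqP; rewrite eq_porbit_mem porbit_drev !inE.
case/orP=> /eqP // Ea; exfalso.
have fX c : c \in X -> c \in forest.
  by case/imsetP => v Fv ->; apply: forest_par.
case/finset.setUP: aX; case/finset.setUP: bX.
- rewrite !inE Ea dtail_rev dhead_rev.
  by case/and3P=> _ bS _ /and3P[_ _]; rewrite bS.
- by move=> /fX bF /exits_forest; rewrite Ea forest_rev bF.
- by move=> /exits_forest bF /fX; rewrite Ea forest_rev (negPf bF).
case/imsetP=> u Fu Eu /imsetP[v Fv Ev].
have := depth_par Fu; have := depth_par Fv.
have : dtail a = dhead b by rewrite Ea dtail_rev.
have : dtail b = dhead a by rewrite Ea dhead_rev.
by rewrite Eu Ev !tail_par // => <- <-; lia.
Qed.

Lemma card_exits g : has_genus G g -> #|exits| <= 2 * g + 1.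
Proof.
rewrite /has_genus /euler_char => genus.
pose N := faces G :\ f.
pose K := [set porbit (drev G) a | a in exits :|: forest].
pose D := porbits (drev G) :\: K.
pose U (c : {ffun {set dart G} -> 'F_2}) a := c (porbit (face_next G) a).
(* Over F_2 the sum over the two darts of an edge is the difference of the potential across it:
   [bd c] is the boundary of [c] restricted to [D]. *)
pose bd c : {ffun {set dart G} -> 'F_2} :=
  [ffun E => if E \in D then (\sum_(a in E) U c a)%R else 0%R].
have bd_pair c a :
    (\sum_(b in porbit (drev G) a) U c b = U c a + U c (drev G a))%R.
  by rewrite porbit_drev big_setU1 ?big_set1 // inE eq_sym drev_neq.
have UB c c' a : (U (c - c') a = U c a - U c' a)%R.
  by rewrite /U !ffunE.
have U_next c a : U c (face_next G a) = U c a.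
  congr (c _); apply/eqP; rewrite eq_porbit_mem.
  by have := mem_porbit (face_next G) 1 a; rewrite expg1.
(* The difference of two potentials with equal [bd] satisfies the hypotheses of [U_const] with value
   0. *)
have bd_inj : {in pffun_on 0%R N predT &, injective bd}.
  move=> c c' /pffun_onP[cN _] /pffun_onP[c'N _] bdE.
  have U0 a : U (c - c')%R a = 0%R.
    apply: U_const a => [a|a af|a aF aE aE']; first exact: U_next.
      rewrite UB /U; have -> : porbit (face_next G) a = f.
        by case/imsetP: face_f af => b _ -> ; rewrite -eq_porbit_mem => /eqP.
      by rewrite !(off_support (D := N)) ?subr0 // setD11.
    have aD : porbit (drev G) a \in D.
      apply/finset.setDP; split; first exact: imset_f.
      apply/imsetP=> -[b bK].
      move/eqP; rewrite eq_porbit_mem porbit_drev !inE.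
      case/orP=> /eqP Ea; move: bK; rewrite finset.in_setU.
        by rewrite -Ea (negPf aE) (negPf aF).
      have -> : b = drev G a by rewrite Ea drevK.
      by rewrite (negPf aE') forest_rev (negPf aF).
    move/ffunP/(_ (porbit (drev G) a)): bdE.
    rewrite !ffunE aD !bd_pair => /eqP.
    rewrite -subr_eq0 opprD addrACA -!UB => /eqP.
    move/eqP; rewrite addr_eq0 => /eqP->.
    by rewrite [RHS](oppr_pchar2 (R := 'F_2)) // pchar_Fp.
  apply/ffunP=> h; have [hN|hN] := boolP (h \in N).
    move: hN; rewrite inE => /andP[_ /imsetP[a _ ->]].
    by move: (U0 a); rewrite UB => /eqP; rewrite subr_eq0 => /eqP.
  by rewrite !(off_support (D := N)).
have bd_D c : bd c \in pffun_on 0%R D predT.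
  apply/pffun_onP; split=> //; apply/fintype.subsetP=> E; rewrite inE ffunE.
  by case: ifP => //; rewrite eqxx.
have : #|N| <= #|D|.
  rewrite -(@leq_exp2l 2) //.
  have := card_pffun_on 0%R (mem N) 'F_2.
  have := card_pffun_on 0%R (mem D) 'F_2.
  rewrite card_Fp // => <- <-; rewrite -(card_in_imset bd_inj).
  by apply/subset_leq_card/fintype.subsetP => _ /imsetP[c _ ->].
rewrite [X in _ <= X]cardsD.
have := card_free_edges; rewrite -/K.
have := subset_leq_card (subsetIl (porbits (drev G)) K).
have := cardsD1 f (faces G); rewrite face_f -/N.
(* Only an inequality, since [x] and [y] may coincide. *)
have : #|vert G| <= #|F| + 2.
  have := cardsC F; have : #|~: F| <= #|[set x; y]|; last first.
    by rewrite cards2; case: (x != y); lia.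
  by apply/subset_leq_card/fintype.subsetP=> v; rewrite !inE negb_and !negbK.
by move: genus; clear; move: (#|_|) (#|_|) (#|_|) (#|_|) (#|_|) (#|_|); lia.
Qed.

End Cut.

(** * Walks, shortest paths and tree walks in a weighted digraph *)

Section Walks.
Variables (R : realType) (G : digraph) (w : dart G -> R).
Hypothesis w_ge0 : forall d, 0 <= w d.
Implicit Types (x y z r : vert G) (p q : seq (dart G)) (A T : {set dart G}).

Lemma is_walk_cat x p q z :
  is_walk x (p ++ q) z = is_walk x p (last x (map (@dhead G) p)) &&
    is_walk (last x (map (@dhead G) p)) q z.
Proof.
elim: p x => [|d p IH] x /=; first by rewrite eqxx.
by rewrite IH andbA.
Qed.

Lemma is_walk_last x p y : is_walk x p y -> last x (map (@dhead G) p) = y.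
Proof.
by elim: p x => [|d p IH] x /=; [move/eqP | case/andP=> _ /IH].
Qed.

Lemma weight_ge0 p : 0 <= weight w p.
Proof. exact: sumr_ge0. Qed.

Lemma weight_cat p q : weight w (p ++ q) = weight w p + weight w q.
Proof. exact: big_cat. Qed.

Lemma weight_cons d p : weight w (d :: p) = w d + weight w p.
Proof. exact: big_cons. Qed.

Lemma walk_split x p y z : is_walk x p y -> z \in x :: map (@dhead G) p ->
  exists p1 p2, [/\ p = p1 ++ p2, is_walk x p1 z & is_walk z p2 y].
Proof.
elim: p x => [|d p IH] x /=.
  by rewrite inE => /eqP<- /eqP->; exists [::], [::]; rewrite /= eqxx.
case/andP=> xd pW; rewrite inE => /orP[/eqP->|zp].
  by exists [::], (d :: p); rewrite /= eqxx xd pW.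
have [p1 [p2 [-> W1 W2]]] := IH _ pW zp.
by exists (d :: p1), p2; rewrite /= xd W1.
Qed.

Lemma walk_to_path x p y : is_walk x p y ->
  exists2 q, is_path x q y & weight w q <= weight w p.
Proof.
elim: p x => [|d p IH] x /=.
  by move=> W; exists [::]; rewrite // /is_path /= W.
case/andP=> xd /IH[q /andP[qW qU] wq].
have [xq|xNq] := boolP (x \in dhead d :: map (@dhead G) q).
  have [q1 [q2 [Eq W1 W2]]] := walk_split qW xq.
  exists q2; last first.
    rewrite weight_cons; apply: le_trans (le_trans wq _); last by rewrite lerDr.
    by rewrite Eq weight_cat lerDr weight_ge0.
  rewrite /is_path W2 /= -(is_walk_last W1).
  move: qU; rewrite Eq map_cat -cat_cons cat_uniq => /and3P[_ H ->].
  rewrite andbT; apply: contra H => H; apply/hasP.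
  by exists (last (dhead d) (map (@dhead G) q1)) => //; apply: mem_last.
exists (d :: q); last by rewrite !weight_cons lerD2l.
by rewrite /is_path /= xd qW -/(map _ (_ :: _)) -/(_ :: _) xNq.
Qed.

Lemma dist_in_le A x p y : walk_in A x p y -> dist_in w A x y <= weight w p.
Proof.
move=> W; apply: ge_inf; last by exists p.
by exists 0 => _ [q _ <-]; apply: weight_ge0.
Qed.

Lemma walk_in_setT x p y : walk_in [set: dart G] x p y = is_walk x p y.
Proof.
rewrite /walk_in andb_idr // => _.
by apply/allP => d _; apply: finset.in_setT.
Qed.

Lemma dist_le x p y : is_walk x p y -> dist w x y <= weight w p.
Proof. by move=> W; apply: dist_in_le; rewrite walk_in_setT. Qed.

(** Existence of a walk matters: the infimum of the empty set is a default value. *)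
Lemma dist_ge c x y : (exists p, is_walk x p y) ->
  (forall p, is_walk x p y -> c <= weight w p) -> c <= dist w x y.
Proof.
case=> p pW c_le; apply: lb_le_inf.
  by exists (weight w p), p => //=; rewrite walk_in_setT.
by move=> _ [q /= qW <-]; apply: c_le; rewrite -walk_in_setT.
Qed.

(** A path has at most as many darts as there are vertices, so finitely many candidates remain, and
    every walk shortens to one of them. *)
Lemma exists_shortest_path x y : (exists p, is_walk x p y) ->
  exists p, is_shortest_path w x p y.
Proof.
case=> p0 /walk_to_path[p1 p1P _].
have path_size p : is_path x p y -> (size p <= #|vert G|)%N.
  case/andP=> _ /= /andP[_ /card_uniqP pE].
  by rewrite -(size_map (@dhead G)) -pE max_card.
pose P (b : #|vert G|.-bseq (dart G)) := is_path x b y.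
case: (arg_minP (fun b : #|vert G|.-bseq (dart G) => weight w b)
  (i0 := Bseq (path_size _ p1P)) (P := P)) => //.
move=> b bP b_min; exists b; split => //.
apply/eqP; rewrite eq_le; apply/andP; split.
  apply: dist_ge; first by exists b; case/andP: bP.
  move=> q /walk_to_path[q' q'P]; apply: le_trans.
  exact: (b_min (Bseq (path_size _ q'P))).
by apply: dist_le; case/andP: bP.
Qed.

Lemma shortest_path_cons x d p y :
  is_shortest_path w x (d :: p) y -> is_shortest_path w (dhead d) p y.
Proof.
case=> /andP[/= /andP[xd pW] /andP[_ pU]] wp.
split; first by rewrite /is_path pW.
apply/eqP; rewrite eq_le dist_le // andbT; apply: dist_ge; first by exists p.
move=> q qW; rewrite -(lerD2l (w d)) -!weight_cons wp.
by apply: dist_le; rewrite /= xd.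
Qed.

(** A revisited vertex would be reached by two tree walks of different lengths. *)
Lemma spt_walk_path T r p y :
  (forall z q q', walk_in T r q z -> walk_in T r q' z -> q = q') ->
  walk_in T r p y -> is_path r p y.
Proof.
move=> T_inj /andP[pW pT]; rewrite /is_path pW.
elim/last_ind: p y pW pT => // p d IH y.
rewrite map_rcons -rcons_cons rcons_uniq -cats1 is_walk_cat => /andP[pW].
rewrite all_cat => dW /andP[pT dT].
have /andP[_ pU] := IH _ pW pT; rewrite pU andbT; apply/negP => yp.
have [p1 [p2 [Ep W1 W2]]] := walk_split pW yp.
suff : size p1 = size (p ++ [:: d]) by rewrite Ep !size_cat /=; lia.
congr size; apply: (T_inj (dhead d)); rewrite /walk_in.
  by rewrite W1; move: pT; rewrite Ep all_cat => /andP[].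
move: dW; rewrite is_walk_cat pW all_cat pT dT /= => /andP[-> _].
by rewrite eqxx.
Qed.

(** The infimum runs over a single walk. Only uniqueness in [T] is used, so this also holds for
    weights under which [T] is no longer a shortest-path tree. *)
Lemma spt_dist_in T r p y :
  (forall z q q', walk_in T r q z -> walk_in T r q' z -> q = q') ->
  walk_in T r p y -> dist_in w T r y = weight w p.
Proof.
move=> T_inj pW; rewrite /dist_in -[RHS]inf1; congr inf.
apply/seteqP; split=> [_ [q /= qW <-]|_ ->]; last by exists p.
by rewrite (T_inj _ _ _ qW pW).
Qed.

End Walks.

(** * Comparing walks in [G] with walks in the graph subdivided at the source *)

Section Subdivision.
Variables (R : realType) (G : embedded_graph) (w : dart G -> R)
  (e : dart G) (l : R).
Hypotheses (w_ge0 : forall d, 0 <= w d) (l_bounds : 0 <= l < 1).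

Let wl : dart (sub_graph e) -> R := @sub_weight R G w e l.

Definition subdivide d : seq (dart (sub_graph e)) :=
  if d == e then [:: inr true; inl d]
  else if d == drev G e then [:: inr false; inl d]
  else [:: inl d].

Lemma sub_weight_ge0 a : 0 <= wl a.
Proof.
case/andP: l_bounds => l0 l1.
by case: a => [d|[]] /=; do ?case: ifP => _ //;
  rewrite mulr_ge0 // subr_ge0 ltW.
Qed.

Lemma subdivide_walk d :
  @is_walk (sub_graph e) (Some (dtail d)) (subdivide d) (Some (dhead d)).
Proof.
rewrite /subdivide; have [->|de] := eqVneq d e; first by rewrite /= !inE !eqxx.
have [->|de'] := eqVneq d (drev G e).
  by rewrite /= !inE !eqxx orbT dtail_rev !eqxx.
by rewrite /= !inE (negPf de) (negPf de') !eqxx.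
Qed.

Lemma weight_subdivide d : weight wl (subdivide d) = w d.
Proof.
rewrite /subdivide; have [->|de] := eqVneq d e.
  by rewrite !weight_cons /weight big_nil /= eqxx; ring.
have [->|de'] := eqVneq d (drev G e).
  by rewrite !weight_cons /weight big_nil /= eqxx (negPf (drev_neq e)); ring.
by rewrite !weight_cons /weight big_nil /= (negPf de) (negPf de') addr0.
Qed.

Lemma subdivide_walks u p v : is_walk u p v ->
  exists2 q, @is_walk (sub_graph e) (Some u) q (Some v) &
             weight wl q = weight w p.
Proof.
elim: p u => [|d p IH] u /=.
  by move=> /eqP->; exists [::]; rewrite /weight ?big_nil /= ?eqxx.
case/andP=> /eqP <- /IH[q qW wq]; exists (subdivide d ++ q); last first.
  by rewrite weight_cons weight_cat weight_subdivide wq.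
by rewrite is_walk_cat (is_walk_last (subdivide_walk d)) subdivide_walk.
Qed.

Lemma dist_source_le a u v :
  a \in [set e; drev G e] -> dhead a = u ->
  dist wl (source e) (Some v) <= wl (inl a) + dist w u v.
Proof.
move=> ae <-; rewrite -lerBlDl; apply: dist_ge; first exact: graph_connected.
move=> p /subdivide_walks[q qW <-]; rewrite lerBlDl -(weight_cons wl).
by apply: (dist_le sub_weight_ge0); rewrite /= ae qW.
Qed.

Lemma walk_off_source u p z :
  @is_walk (sub_graph e) (Some u) p (Some z) ->
  source e \notin map (@dhead (sub_graph e)) p ->
  exists q, [/\ p = map inl q, is_walk u q z &
                all (fun d => d \notin [set e; drev G e]) q].
Proof.
elim: p u => [|[d|b] p IH] u /=.
- by move=> /eqP[->] _; exists [::]; rewrite /= eqxx.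
- case: ifPn => //= de /andP[/eqP[<-]] /IH{}IH.
  rewrite inE /= => /IH[q [-> qW qN]].
  by exists (d :: q); rewrite /= eqxx de.
- by [].
Qed.

(** A simple path never returns to the source, so after its first dart it stays in [G] and avoids
    both darts of [e]. *)
Lemma source_path_decomp p z :
  @is_path (sub_graph e) (source e) p (Some z) ->
  exists a q, [/\ p = inl a :: map inl q, a \in [set e; drev G e],
    is_path (dhead a) q z & all (fun d => d \notin [set e; drev G e]) q].
Proof.
case: p => [|[a|b] p]; rewrite /is_path //=.
case: ifP => //= ae /and4P[pW].
rewrite inE /= => /(walk_off_source pW)[q [-> qW qN]] sq qU.
exists a, q; split=> //; rewrite /is_path qW /=.
have someI : injective (@Some (vert G)) by move=> ? ? [].
rewrite -(mem_map someI) -(map_inj_uniq someI) -!map_comp.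
by rewrite -map_comp in sq; rewrite -map_comp in qU; rewrite sq.
Qed.

Lemma weight_inl q :
  all (fun d => d \notin [set e; drev G e]) q ->
  weight wl (map inl q) = weight w q.
Proof.
elim: q => [|d q IH] /=; first by rewrite /weight !big_nil.
case/andP; rewrite !inE negb_or => /andP[/negPf de /negPf de'] /IH qE.
by rewrite !weight_cons qE /= de de'.
Qed.

End Subdivision.

(** * The two competing paths at a pivot *)

Section Pivots.
Variables (R : realType) (G : embedded_graph) (w : dart G -> R).
Hypothesis w_ge0 : forall d, 0 <= w d.
Variables (e : dart G) (l : R) (T : {set dart (sub_graph e)}) (d : dart G).
Hypotheses (l_bounds : 0 <= l < 1) (dT_tense : becomes_tense w l T d).

(* At the pivot the new tree path to dhead d is s -> dhead e followed by p, and
   the old one is s -> dtail e followed by q. *)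
Lemma becomes_tense_paths : exists p q,
  [/\ is_shortest_path w (dhead e) p (dhead d),
      is_shortest_path w (dtail e) q (dhead d),
      0 < w e + w (drev G e) &
      l * w (drev G e) + dist w (dtail e) (dhead d) =
        (1 - l) * w e + dist w (dhead e) (dhead d)] /\
  [/\ last e p = d, forall a, a \in q -> (inl a : dart (sub_graph e)) \in T &
      forall a, (inl a : dart (sub_graph e)) \in T -> dhead a = dhead d ->
        last (drev G e) q = a].
Proof.
case: dT_tense => spt dT slack0 [eps eps0 slack_neg].
case/andP: (l_bounds) => l0 l1.
have T_inj z q q' :
    walk_in T (source e) q z -> walk_in T (source e) q' z -> q = q'.
  by case: (spt z) => r _ rE /rE-> /rE->.
have append Q (a : dart (sub_graph e)) z : walk_in T (source e) Q (dtail a) ->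
    dhead a = z -> is_walk (source e) (Q ++ [:: a]) z.
  by case/andP=> QW _ <-; rewrite is_walk_cat (is_walk_last QW) QW /= !eqxx.
set y : vert (sub_graph e) := Some (dhead d).
have [old [oldW w_old] _] := spt y.
have [Q [QW wQ] _] := spt (dtail (inl d : dart (sub_graph e))).
set new := Q ++ [:: inl d : dart (sub_graph e)].
have newW : is_walk (source e) new y by apply: append QW _.
(* A parameter just after [l], kept below 1 so that the subdivided weights remain non-negative. *)
have [l' [ll' l'1 l'eps]] : exists l', [/\ l < l', l' < 1 & l' < l + eps].
  by case: (lerP (1 - l) eps) => H;
    [exists (l + (1 - l) / 2)|exists (l + eps / 2)]; split; lra.
have l'_bounds : 0 <= l' < 1 by rewrite l'1 (le_trans l0 (ltW ll')).
have wl'_ge0 := sub_weight_ge0 w_ge0 (e := e) l'_bounds.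
have wnew l1' : weight (sub_weight w l1') new =
    weight (sub_weight w l1') Q + sub_weight w l1' (inl d : dart (sub_graph e)).
  by rewrite weight_cat /weight big_seq1.
have eq_l : weight (sub_weight w l) new = weight (sub_weight w l) old.
  by apply/eqP; rewrite -subr_eq0 wnew wQ w_old; apply/eqP.
have lt_l' : weight (sub_weight w l') new < weight (sub_weight w l') old.
  have /slack_neg : l < l' < l + eps by rewrite ll'.
  rewrite /slack_in (spt_dist_in _ T_inj QW) (spt_dist_in _ T_inj oldW).
  by rewrite subr_lt0 -wnew.
(* If [new] met [y] before its end, it would extend the tree walk [old] and could not be lighter at
   [l']. *)
have newP : is_path (source e) new y.
  have /andP[_ QU] := spt_walk_path T_inj QW; case/andP: (QW) => Q_walk Q_T.
  rewrite /is_path newW /new map_cat -cat_cons cat_uniq QU /= orbF andbT.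
  apply/negP => yQ; have [Q1 [Q2 [EQ Q1W _]]] := walk_split Q_walk yQ.
  move: lt_l'; rewrite ltNge /new EQ (T_inj y old Q1 oldW) ?weight_cat.
    by rewrite -addrA lerDl addr_ge0 ?weight_ge0.
  by rewrite /walk_in Q1W; move: Q_T; rewrite EQ all_cat => /andP[].
have oldP : is_path (source e) old y := spt_walk_path T_inj oldW.
have [a [p [newE ae pP pN]]] := source_path_decomp newP.
have [b [q [oldE be qP qN]]] := source_path_decomp oldP.
have wE (l1' : R) (c : dart G) r :
    all (fun d => d \notin [set e; drev G e]) r ->
    weight (sub_weight w l1') (inl c :: map inl r : seq (dart (sub_graph e))) =
    sub_weight w l1' (inl c : dart (sub_graph e)) + weight w r.
  by move=> rN; rewrite weight_cons weight_inl.
move: eq_l (lt_l'); rewrite newE oldE !wE // => eq_l lt_l.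
have shortest c r (cr := inl c :: map inl r : seq (dart (sub_graph e))) :
    c \in [set e; drev G e] -> is_path (dhead c) r (dhead d) ->
    all (fun d => d \notin [set e; drev G e]) r ->
    weight (sub_weight w l) cr = dist (sub_weight w l) (source e) y ->
    is_shortest_path w (dhead c) r (dhead d).
  move=> ce rP rN; rewrite wE // => rE; split=> //; apply/eqP.
  rewrite eq_le dist_le ?andbT; [|exact: w_ge0|by case/andP: rP].
  rewrite -(lerD2l (sub_weight w l (inl c : dart (sub_graph e)))) rE.
  exact: dist_source_le.
have p_shortest : is_shortest_path w (dhead a) p (dhead d).
  by apply: shortest => //; rewrite wE // eq_l -wE // -oldE.
have q_shortest : is_shortest_path w (dhead b) q (dhead d).
  by apply: shortest => //; rewrite -oldE.
have swE (l1' : R) :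
    sub_weight w l1' (inl e : dart (sub_graph e)) = (1 - l1') * w e.
  by rewrite /= eqxx.
have swE' (l1' : R) :
    sub_weight w l1' (inl (drev G e) : dart (sub_graph e)) = l1' * w (drev G e).
  by rewrite /= (negPf (drev_neq e)) eqxx.
have we := w_ge0 e; have we' := w_ge0 (drev G e).
have head_rev : dhead (drev G e) = dtail e by rewrite -dtail_rev drevK.
case: p_shortest q_shortest => _ wp [_ wq].
move: eq_l lt_l; rewrite wp wq.
(* The two walks have equal weight at [l] and [new] is lighter at [l']. They cannot start with the
   same dart, as their difference would then be constant in [l]; nor can [new] start towards the
   tail of [e], where its weight does not decrease while that of [old] does not increase. *)
case/set2P: ae newE pP wp => -> newE pP wp; last first.
  case/set2P: be {oldE} => ->; rewrite ?swE ?swE'; last first.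
    by move=> _; rewrite ltxx.
  move=> eq_l lt_l; have : 0 <= (l' - l) * (w e + w (drev G e)).
    by apply: mulr_ge0; [rewrite subr_ge0 ltW | rewrite addr_ge0].
  nra.
case/set2P: be oldE qP wq => -> oldE qP wq; rewrite ?swE ?swE' ?head_rev.
  by move=> _; rewrite ltxx.
rewrite head_rev in qP wq.
move=> eq_l lt_l; exists p, q; split; split=> //.
(* If both weights vanished, the tie at [l] would persist at [l']. *)
- rewrite lt_neqAle addr_ge0 // andbT eq_sym paddr_eq0 //.
  apply: contraTN lt_l => /andP[/eqP we0 /eqP we'0].
  by move: eq_l; rewrite we0 we'0 !mulr0 => ->; rewrite ltxx.
- have : last (inl e) new = inl d :> dart (sub_graph e).
    by rewrite /new last_cat.
  by rewrite newE /= last_map => -[].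
- move=> c cq; case/andP: (oldW) => _ /allP; apply.
  by rewrite oldE in_cons map_f ?orbT.
(* A tree walk to the tail of [c] followed by [c] must be [old]. If [q] is empty, the last dart of
   [old] is [inl (drev G e)], whence the default of [last]. *)
- move=> c cT cd.
  have [Q' [Q'W _] _] := spt (dtail (inl c : dart (sub_graph e))).
  have : Q' ++ [:: inl c : dart (sub_graph e)] = old.
    apply: T_inj oldW; rewrite /walk_in append //=; last by rewrite cd.
    by rewrite all_cat /= cT; case/andP: Q'W => _ ->.
  rewrite oldE => /(congr1 (last (inl c))).
  by rewrite last_cat /= last_map => -[].
Qed.

End Pivots.

(** Reduces counting positions of the source to counting edges of the facial walk, once each edge
    carries at most one position. *)
Lemma card_le_fst (A : choiceType) (T : finType) (P : set (T * A))
    (X : {set T}) :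
  (forall q, P q -> q.1 \in X) ->
  (forall q q', P q -> P q' -> q.1 = q'.1 -> q = q') ->
  (P #<= `I_#|X|)%card.
Proof.
move=> PX P_inj; pose h (q : T * A) := index q.1 (enum X).
have h_inj : {in P &, injective h}.
  move=> q q'; rewrite !inE => qP q'P hE; apply: P_inj => //.
  have X_enum r : P r -> r.1 \in enum X by move/PX; rewrite mem_enum.
  exact: (index_inj q.1 (X_enum _ qP) (X_enum _ q'P) hE).
have /card_eqPle[_ /card_le_trans] := inj_card_eq h_inj; apply.
apply: subset_card_le => _ [q /PX qX <-] /=.
by rewrite cardE index_mem mem_enum.
Qed.

Lemma map_uniq_inj (T1 T2 : eqType) (h : T1 -> T2) (s : seq T1) :
  uniq (map h s) -> {in s &, injective h}.
Proof.
elim: s => //= a s IH /andP[aN /IH{}IH] b c; rewrite !inE.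
case/orP=> [/eqP->|bs] /orP[/eqP->|cs] // E; last exact: IH.
  by rewrite E map_f in aN.
by rewrite -E map_f in aN.
Qed.

(** * Counting the pivots of [d] during one turn around [f] *)

Section Turn.
Variables (R : realType) (G : embedded_graph) (w : dart G -> R) (g : nat)
  (f : {set dart G}) (d : dart G).
Hypotheses (w_ge0 : forall d, 0 <= w d) (G_genus : has_genus G g)
  (face_f : f \in faces G)
  (w_unique : forall x y p p', is_shortest_path w x p y ->
     is_shortest_path w x p' y -> p = p').

Let route v : seq (dart G) :=
  projT1 (cid (exists_shortest_path w_ge0 (graph_connected v (dhead d)))).

Let routeP v : is_shortest_path w v (route v) (dhead d).
Proof. by rewrite /route; case: cid. Qed.

Let route_eq v p : is_shortest_path w v p (dhead d) -> route v = p.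
Proof. exact: w_unique. Qed.

Let users := [set v | d \in route v].

Let route_cons v : v != dhead d ->
  exists2 a, dtail a = v & route v = a :: route (dhead a).
Proof.
move=> vy; case E: (route v) => [|a p].
  have [/andP[vE _] _] := routeP v.
  by move: vE; rewrite E /= (negPf vy).
have := routeP v; rewrite E => aP; exists a.
  by case: aP => /andP[/andP[/eqP]].
by rewrite (route_eq (shortest_path_cons w_ge0 aP)).
Qed.

(** The forest consists of the first darts of the routes, with depth the route length. Since
    [dtail d] is made a root, no parent dart is [d], so a vertex and its parent are both in [users]
    or both outside. *)
Lemma card_exits_users (S : {set vert G}) : S = users \/ S = ~: users ->
  (#|[set a in f | (dtail a \in S) && (dhead a \notin S)]| <= 2 * g + 1)%N.
Proof.
move=> SE.
have cutS u v : (u \in users) = (v \in users) -> (u \in S) = (v \in S).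
  by case: SE => -> // E; rewrite !finset.in_setC E.
pose par v := head d (route v); pose depth v := size (route v).
have parE v : v \in [set v | (v != dtail d) && (v != dhead d)] ->
    dtail (par v) = v /\ route v = par v :: route (dhead (par v)).
  by rewrite inE => /andP[_ /route_cons[a av vE]]; rewrite /par vE.
apply: (@card_exits G (dtail d) (dhead d) par depth) => // v vF;
  have [tv vE] := parE v vF => //.
  by rewrite /depth vE.
apply: cutS; rewrite !inE vE in_cons; move: vF; rewrite inE => /andP[vd _].
by case: eqVneq => // dE; rewrite dE tv eqxx in vd.
Qed.

(** Both parameters solve the same affine equation, whose slope [w e + w (drev G e)] is positive: an
    edge carries at most one pivot at a given head. *)
Let position_inj (q q' : dart G * R) (T : {set dart (sub_graph q.1)})
    (T' : {set dart (sub_graph q'.1)}) d1 d2 :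
  q.1 = q'.1 -> position f q -> position f q' -> dhead d1 = dhead d2 ->
  becomes_tense w q.2 T d1 -> becomes_tense w q'.2 T' d2 -> q = q'.
Proof.
case: q q' T T' => e l [e' l'] /= T T' E; subst e' => -[_ l_b] [_ l'_b] d12.
move=> /(becomes_tense_paths w_ge0 l_b)[p [r [[_ _ wpos lE] _]]].
move=> /(becomes_tense_paths w_ge0 l'_b)[p' [r' [[_ _ _ l'E] _]]].
rewrite -d12 in l'E; move: lE l'E => /= lE l'E.
congr (_, _); apply: (mulIf (lt0r_neq0 wpos)); lra.
Qed.

Let special := [set d; drev G d].

(** The constant 5 comes from 2 + (2g + 1) <= 5g for g >= 1. *)
Let card_special (K : {set dart G}) : (#|K| <= 2 * g + 1)%N -> (1 <= g)%N ->
  (#|special :|: K| <= 5 * g)%N.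
Proof.
have := (leq_card_setU special K).1; rewrite cards2.
by move: (leq_b1 (d != drev G d)); lia.
Qed.

(** Unless [e] is [d], the dart [d] ends the route from the head of [e]. It is not in the tree,
    hence not on the route from the tail of [e]; so [e] leaves the complement of [users]. *)
Lemma card_pivots_in : (1 <= g)%N ->
  [set q | position f q /\ pivots_in w d q]%classic #<= `I_(5 * g)%N.
Proof.
move=> g1; have := card_special (card_exits_users (or_intror erefl)) g1.
rewrite -card_le_II; apply: card_le_trans; apply: card_le_fst.
  move=> [e l] [[/= ef l_b] [T tense]]; have [_ dT _ _] := tense.
  have [p [q [[pS qS _ _] [pd qT _]]]] := becomes_tense_paths w_ge0 l_b tense.
  rewrite !inE; case: (eqVneq e d) => //= ed.
  rewrite ef (route_eq pS) (route_eq qS) negbK.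
  have -> : d \in p by move: (mem_last e p); rewrite pd inE eq_sym (negPf ed).
  by rewrite andbT orbC; case: (boolP (d \in q)) => // /qT; rewrite (negPf dT).
move=> q q' [qp [T Tq]] [q'p [T' T'q']] E.
exact: (position_inj E qp q'p erefl Tq T'q').
Qed.

(** Unless [d] is the reversal of [e], it ends the route from the tail of [e]. The route from the
    head of [e] enters the same vertex by [d'], and being simple it avoids [d]; so [e] leaves
    [users]. *)
Lemma card_pivots_out : (1 <= g)%N ->
  [set q | position f q /\ pivots_out w d q]%classic #<= `I_(5 * g)%N.
Proof.
move=> g1; have := card_special (card_exits_users (or_introl erefl)) g1.
rewrite -card_le_II; apply: card_le_trans; apply: card_le_fst.
  move=> [e l] [[/= ef l_b] [T [d' [tense dT dd']]]]; have [_ d'T _ _] := tense.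
  have [p [q [[pS qS _ _] [pd _ qd]]]] := becomes_tense_paths w_ge0 l_b tense.
  have := qd _ dT dd'; move: pS qS; rewrite -dd' => pS qS q_last.
  rewrite !inE ef (route_eq pS) (route_eq qS).
  have [->|ed] := eqVneq d (drev G e); first by rewrite drevK eqxx orbT.
  have -> : d \in q.
    by move: (mem_last (drev G e) q); rewrite q_last inE (negPf ed).
  rewrite orbC /=; apply/orP; left; apply/negP => dp.
  (* Containing [d], the path [p] is nonempty, so its last dart is [d'] and not the default [e]. *)
  have d'p : d' \in p.
    by case: (p) dp pd => // a r _ /= <-; apply: mem_last.
  have [/andP[_ /andP[_ /map_uniq_inj p_uniq]] _] := pS.
  by rewrite -(p_uniq _ _ dp d'p dd') dT in d'T.
move=> q q' [qp [T [a [Tq dT da]]]] [q'p [T' [a' [T'q' _ da']]]] E.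
by apply: (position_inj E qp q'p _ Tq T'q'); rewrite -da.
Qed.

End Turn.

Theorem lemma4p3 (R : realType) :
  exists C : nat,
  forall (G : embedded_graph) (w : dart G -> R) (g : nat) (f : {set dart G}),
    (1 <= g)%N -> has_genus G g -> f \in faces G ->
    (forall d, 0 <= w d) -> generic w f ->
    forall d : dart G,
      ([set q | position f q /\ pivots_in w d q]%classic #<= `I_(C * g)%N) /\
      ([set q | position f q /\ pivots_out w d q]%classic #<= `I_(C * g)%N).
Proof.
exists 5%N => G w g f g1 G_genus face_f w_ge0 [w_unique _] d; split.
  exact: card_pivots_in.
exact: card_pivots_out.
Qed.
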